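(* Let $n\ge1$ and let $c,u_1,\dots,u_n,v_1,\dots,v_n$ be complex parameters in general position. Then \begin{align*} &\mathrm{Sym}_c\Bigg((1-\tau)^n\prod_{j=1}^n\prod_{k=1}^n\frac{u_j-v_k-c}{u_j-v_k}\Bigg)\\ =&\frac{n!\,c^n\prod_{i=1}^n\prod_{k=1}^n(v_i-u_k+c)}{\prod_{1\le i<j\le n}(v_j-v_i)\prod_{1\le i<j\le n}(u_i-u_j)}\det_{1\le j,k\le n}\Bigg(\frac{1}{(v_j-u_k+c)(v_j-u_k)}\Bigg). \end{align*}
   Context: The symmetrization is $\mathrm{Sym}_c(g(u_1,\dots,u_n)):=\sum_{w\in S_n}w\cdot\big(\Delta(1,2,\dots,n)\,g(u_1,\dots,u_n)\big)$, where $S_n$ acts by permuting the variables $u_1,\dots,u_n$ ($w$ replaces $u_i$ by $u_{w(i)}$) and $\Delta(k_1,\dots,k_n):=\prod_{1\le i<j\le n}\frac{u_{k_i}-u_{k_j}-c}{u_{k_i}-u_{k_j}}$. The operator $\tau$ acts on variables and functions by $\tau u_j:=u_{j+1}$ for $j=1,\dots,n-1$ and $\tau\Big(\frac{u_n-v_k-c}{u_n-v_k}\Big):=1$ (multiplicatively on products of the factors $\frac{u_j-v_k-c}{u_j-v_k}$, with $\tau(1)=1$). Thus $\tau^\ell\prod_{j=1}^n\prod_{k=1}^n\frac{u_j-v_k-c}{u_j-v_k}=\prod_{j=\ell+1}^n\prod_{k=1}^n\frac{u_j-v_k-c}{u_j-v_k}$ for $0\le\ell\le n$, and $(1-\tau)^n=\sum_{\ell=0}^n(-1)^\ell\binom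 n\ell\tau^\ell$. ''In general position'' means that zeros of all factors in denominators are avoided. *)

(* Defs.v *)
From mathcomp Require Import all_boot all_order all_fingroup all_algebra.
From mathcomp Require Import complex.
From mathcomp Require Import mpoly.
From mathcomp Require Import reals.

Set Implicit Arguments.
Unset Strict Implicit.
Unset Printing Implicit Defensive.

Import GRing.Theory.
Local Open Scope ring_scope.

(* The indices 1, ..., n are represented by 'I_n = {0, ..., n-1}. *)

Section SymTau.
Variables (F : fieldType) (n : nat).
Implicit Types (c : F) (u v : 'I_n -> F).

Definition Delta c u : F :=
  \prod_(i < n) \prod_(j < n | (i < j)%N) ((u i - u j - c) / (u i - u j)).

(* A permutation w replaces u_i by u_(w i), so it sends the function f of u
   to u |-> f (u \o w). *)
Definition symc c (g : ('I_n -> F) -> F) u : F :=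
  \sum_(w : 'S_n) Delta c (u \o w) * g (u \o w).

(* The operator tau is prescribed on the factors (u_j - v_k - c) / (u_j - v_k)
   and extended multiplicatively and linearly. It is therefore defined on the
   commutative algebra freely generated by one formal symbol for each factor,
   that is, on the polynomials in n * n variables, which are numbered by
   enum_rank. *)
Local Notation factors := {mpoly F[#|{: 'I_n * 'I_n}|]}.

Definition factor (j k : 'I_n) : factors := 'X_(enum_rank (j, k)).

(* insub j.+1 is the index following j if there is one, and None when j is the
   last index. *)
Definition tau_factor (jk : 'I_n * 'I_n) : factors :=
  if insub jk.1.+1 is Some j' then factor j' jk.2 else 1.

Definition tau (p : factors) : factors :=
  p \mPo [tuple tau_factor (enum_val i) | i < #|{: 'I_n * 'I_n}|].

(* The power (1 - tau)^m of operators. *)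
Definition one_sub_tau_pow (m : nat) (p : factors) : factors :=
  iter m (fun q => q - tau q) p.

Definition eval_factors c v (p : factors) u : F :=
  p.@[fun i => let: (j, k) := enum_val i in (u j - v k - c) / (u j - v k)].

End SymTau.

Arguments factor {F n} j k.

(* Main.v *)
Require Import Defs.
From mathcomp Require Import all_boot all_order all_fingroup all_algebra.
From mathcomp Require Import complex mpoly reals ring.

(** Write f j for the product over k of (u_j - v_k - c) / (u_j - v_k), and
h i j for (u_i - u_j - c) / (u_i - u_j). Both sides are n! times the same sum
over subsets T of the index set,
<<
   sum_T (-1)^#|T| (prod_(i in T, j notin T) h i j) (prod_(j notin T) f j).
>>

On the left, the binomial theorem for 1 - tau leaves, for each l, the
symmetrization of the product of the f j over the positions j >= l. Group its
n! terms by the set T of the l variables that occupy the positions before l: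
the factors of Delta between T and its complement depend on T only, and the
orders inside T and inside its complement contribute l! and (n - l)!, because
the symmetrization of 1 over k variables is k!. The latter rests on the identity
<<
   sum_(i in T) prod_(j in T, j != i) h i j = #|T|,
>>
which is a Lagrange interpolation formula ([sum_prod_ratio]). Peeling off the
first position turns the grouping into an induction on l, whose step is this
same identity ([split_sumS], [symc_tail]). The weight l! (n - l)! cancels
the binomial coefficient up to n!.

On the right, c / ((v - u + c) (v - u)) = 1 / (v - u) - 1 / (v - (u - c)), so
multilinearity in the columns expands the determinant into 2^n Cauchy
determinants, in which the u_k with k in T are shifted to u_k - c
([det_sub_expand], [det_Cauchy]). Dividing each of them by the products of the
differences of the v_j and of the unshifted u_k, and multiplying by all
v_i - u_k + c, leaves the T-term of the sum ([prod_shift],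
[Izergin_expansion]). *)

Set Implicit Arguments.
Unset Strict Implicit.
Unset Printing Implicit Defensive.

Import GRing.Theory.
Local Open Scope ring_scope.
Local Open Scope complex_scope.

(** * Lagrange interpolation and the ratio identity *)

Section Lagrange.

Variables (F : fieldType) (I : finType) (u : I -> F).
Hypothesis u_inj : injective u.

(** Lagrange interpolation at the #|T| nodes u_i recovers p, and the Lagrange
basis polynomials are monic up to scaling: compare leading coefficients. *)
Lemma sum_lagrange (T : {set I}) (p : {poly F}) :
    (size p <= #|T|)%N ->
  \sum_(i in T) p.[u i] / \prod_(j in T :\ i) (u i - u j) = p`_(#|T|.-1).
Proof.
move=> szp.
pose b i : {poly F} := \prod_(j in T :\ i) ('X - (u j)%:P).
have bE i k : (b i).[u k] = \prod_(j in T :\ i) (u k - u j).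
  by rewrite horner_prod; apply: eq_bigr => j _; rewrite !hornerE.
have szb i : i \in T -> size (b i) = #|T|.
  by move=> iT; rewrite /b -big_enum size_prod_XsubC -cardE [RHS](cardsD1 i) iT.
have bN0 i : \prod_(j in T :\ i) (u i - u j) != 0.
  apply/prodf_neq0 => j; rewrite !inE => /andP[jNi _].
  by rewrite subr_eq0 (inj_eq u_inj) eq_sym.
pose w i := p.[u i] / \prod_(j in T :\ i) (u i - u j).
pose q := \sum_(i in T) w i *: b i.
suff pq : p = q.
  rewrite [in RHS]pq coef_sum; apply: eq_bigr => i iT.
  rewrite coefZ -(szb i iT) -lead_coefE.
  have /monicP -> : b i \is monic by apply: monic_prod_XsubC.
  by rewrite mulr1.
apply/eqP; rewrite -subr_eq0; apply/negPn/negP => pqN0.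
have q_roots : all (root (p - q)) [seq u i | i <- enum T].
  rewrite all_map; apply/allP => i; rewrite mem_enum /= => iT.
  rewrite /root hornerD hornerN horner_sum (bigD1 i) //= big1 => [|j /andP[jT jNi]].
    by rewrite addr0 hornerZ bE mulrVK ?subrr // unitfE.
  by rewrite hornerZ bE (bigD1 i) /= ?subrr ?mul0r ?mulr0 // !inE eq_sym jNi.
have := max_poly_roots pqN0 q_roots.
rewrite size_map -cardE map_inj_uniq // enum_uniq => /(_ isT).
apply/negP; rewrite -leqNgt.
rewrite (leq_trans (size_polyD _ _)) // geq_max szp size_polyN /=.
apply: leq_trans (size_sum _ _ _) _; apply/bigmax_leqP => i iT.
by rewrite -(szb i iT) size_scale_leq.
Qed.

Variable c : F.

Local Notation h i j := ((u i - u j - c) / (u i - u j)).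

(** Apply [sum_lagrange] to the difference of the products over j in T of
X - (u_j + c) and of X - u_j. Its value at u_i is - c times the numerator
of the i-th product, and its coefficient of degree #|T| - 1 is - c * #|T|. For c = 0 this is void,
but then every ratio is 1. *)
Lemma sum_prod_ratio (T : {set I}) :
  \sum_(i in T) \prod_(j in T :\ i) h i j = #|T|%:R.
Proof.
have [->|TN0] := eqVneq T set0; first by rewrite big_set0 cards0.
have [c0|cN0] := eqVneq c 0.
  rewrite -sumr_const; apply: eq_bigr => i _; apply: big1 => j.
  rewrite !inE c0 subr0 => /andP[jNi _]; rewrite divff // subr_eq0.
  by rewrite (inj_eq u_inj) eq_sym.
pose b a : {poly F} := \prod_(j in T) ('X - (u j + a)%:P).
have szb a : size (b a) = #|T|.+1 by rewrite /b -big_enum size_prod_XsubC -cardE.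
have b_monic a : b a \is monic by apply: monic_prod_XsubC.
have coefb a : (b a)`_(#|T|.-1) = - \sum_(j in T) (u j + a).
  rewrite /b -!big_enum /=.
  rewrite -[in LHS](big_map (fun j => u j + a) xpredT (fun t => 'X - t%:P)).
  rewrite -[in RHS](big_map (fun j => u j + a) xpredT id).
  rewrite cardE -(size_map (fun j => u j + a)) coefPn_prod_XsubC //.
  by rewrite size_map -cardE cards_eq0.
(* Both products are monic of the same degree, so the degree drops. *)
have szp : (size (b c - b 0)%R <= #|T|)%N.
  apply/leq_sizeP => k; rewrite leq_eqVlt coefB => /orP[/eqP <-|Tk].
    have lb a : (b a)`_(#|T|) = 1.
      by have /monicP := b_monic a; rewrite lead_coefE szb.
    by rewrite !lb subrr.
  by rewrite !nth_default ?subrr // szb.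
have := sum_lagrange szp.
rewrite coefB !coefb !big_split /= !sumr_const mul0rn addr0 opprD opprK addrAC.
rewrite addNr add0r => E; apply: (@mulfI _ (- c)); first by rewrite oppr_eq0.
rewrite mulr_natr mulNrn -E big_distrr /=; apply: eq_bigr => i iT.
have bE a : (b a).[u i] = - a * \prod_(j in T :\ i) (u i - u j - a).
  rewrite horner_prod (big_setD1 i) //= !hornerE opprD addNKr.
  by congr (_ * _); apply: eq_bigr => j _; rewrite !hornerE opprD addrA.
by rewrite hornerD hornerN !bE oppr0 mul0r subr0 prodf_div mulrA.
Qed.

End Lagrange.

(** * Symmetrization over permutations as a sum over subsets *)

Section SymPerm.

(** A permutation of n + 1 points is its value i at the first point together
with a permutation of the others. *)
Lemma sum_perm_recl (V : nmodType) (n : nat) (G : 'S_n.+1 -> V) :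
  \sum_w G w = \sum_(i < n.+1) \sum_(s : 'S_n) G (lift_perm ord0 i s).
Proof.
rewrite (partition_big (fun w : 'S_n.+1 => w ord0) xpredT) //=.
apply: eq_bigr => i _; rewrite (reindex (lift_perm ord0 i)) /=.
  by apply: eq_bigl => s; rewrite lift_perm_id eqxx.
pose g (w : 'S_n.+1) k := odflt k (unlift (w ord0) (w (lift ord0 k))).
have gK (w : 'S_n.+1) k : lift (w ord0) (g w k) = w (lift ord0 k).
  rewrite /g; have := neq_lift ord0 k.
  by rewrite -(inj_eq (@perm_inj _ w)) => /unlift_some[? ? ->].
have g_inj w : injective (g w).
  move=> k l /(congr1 (lift (w ord0))); rewrite !gK.
  by move=> /perm_inj /lift_inj.
exists (fun w => perm (@g_inj w)) => [s _|w /eqP wi]; apply/permP => k.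
  by apply: (@lift_inj _ i); rewrite permE -{1}(lift_perm_id ord0 i s) gK lift_perm_lift.
case: (unliftP ord0 k) => [l|] ->; rewrite ?lift_perm_id // lift_perm_lift.
by rewrite permE -wi gK.
Qed.

Variables (F : fieldType) (I : finType) (c : F) (u : I -> F).
Hypothesis u_inj : injective u.

Local Notation h i j := ((u i - u j - c) / (u i - u j)).

Lemma Delta_recl n (y : 'I_n.+1 -> F) :
  Delta c y =
  \prod_(j < n) ((y ord0 - y (lift ord0 j) - c) / (y ord0 - y (lift ord0 j))) *
  Delta c (y \o lift ord0).
Proof.
rewrite /Delta big_ord_recl; congr (_ * _).
  by rewrite big_mkcond big_ord_recl /= mul1r.
apply: eq_bigr => i _; rewrite big_mkcond big_ord_recl /= mul1r -big_mkcond /=.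
by apply: eq_bigl.
Qed.

(** The terms with #|T| = l of the sum over subsets, relative to an ambient set
A of variables so that variables can be removed one by one. *)
Definition split_sum (f : I -> F) (A : {set I}) l : F :=
  \sum_(T : {set I} | (T \subset A) && (#|T| == l))
    (\prod_(i in T) \prod_(j in A :\: T) h i j) * \prod_(j in A :\: T) f j.

(** Pairs (i, T) with T a subset of A minus i correspond to pairs (i, i |: T);
for a fixed set i |: T the sum over its element i is given by
[sum_prod_ratio]. *)
Lemma split_sumS f (A : {set I}) l :
  \sum_(i in A) (\prod_(j in A :\ i) h i j) * split_sum f (A :\ i) l =
  l.+1%:R * split_sum f A l.+1.
Proof.
rewrite /split_sum.
transitivity (\sum_(i in A) \sum_(T : {set I} | [&& T \subset A, #|T| == l.+1 & i \in T])
   \prod_(j in T :\ i) h i j *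
   ((\prod_(a in T) \prod_(b in A :\: T) h a b) * \prod_(b in A :\: T) f b)).
  apply: eq_bigr => i iA; rewrite big_distrr /=.
  rewrite [RHS](reindex_onto (fun T => i |: T) (fun T => T :\ i)) /=; last first.
    by move=> T /and3P[_ _ iT]; rewrite setD1K.
  apply: eq_big => [T|T /andP[sTA _]].
    rewrite subsetD1; have [iT|iNT] := boolP (i \in T).
      rewrite andbF; apply/esym/negbTE; rewrite negb_and orbC.
      by apply/orP; left; apply/eqP => TE; move: iT; rewrite -TE !inE eqxx.
    rewrite setU1K // eqxx cardsU1 iNT add1n eqSS setU11 subUset sub1set iA.
    by rewrite !andbT.
  have iNT : i \notin T by move: sTA; rewrite subsetD1 => /andP[].
  have -> : A :\: (i |: T) = A :\ i :\: T by rewrite setDDl.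
  have /setIidPr AT := sTA.
  by rewrite setU1K // big_setU1 //= (big_setID T) /= AT !mulrA.
rewrite (exchange_big_dep (fun T : {set I} => (T \subset A) && (#|T| == l.+1))) /=; last first.
  by move=> i T _ /and3P[-> ->].
rewrite big_distrr /=; apply: eq_bigr => T /andP[sTA /eqP cT].
rewrite -cT -(sum_prod_ratio u_inj c) big_distrl /=.
apply: eq_bigl => i; rewrite sTA cT eqxx /=.
by case iT : (i \in T); rewrite ?andbF // (subsetP sTA).
Qed.

Lemma imset_lift n (x : 'I_n.+1 -> I) (i : 'I_n.+1) : injective x ->
  [set x (lift i j) | j : 'I_n] = [set x j | j : 'I_n.+1] :\ x i.
Proof.
move=> x_inj; apply/setP => k; rewrite !inE; apply/imsetP/andP => [[j _ ->]|].
  by rewrite (inj_eq x_inj) eq_sym neq_lift imset_f.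
case=> kNi /imsetP[j _ kE]; rewrite kE in kNi *.
case: (unliftP i j) kNi => [l ->|->]; last by rewrite eqxx.
by exists l.
Qed.

(** The factors of Delta at the first position see only which variable is there,
since they multiply over all the others. The injection x makes the induction on
n possible: it keeps the variables that are left after removals inside the same
index type I. *)
Lemma Delta_lift_perm n (x : 'I_n.+1 -> I) (i : 'I_n.+1) (s : 'S_n) : injective x ->
  Delta c (u \o x \o lift_perm ord0 i s) =
  \prod_(j in [set x j | j : 'I_n.+1] :\ x i) h (x i) j *
  Delta c (u \o (x \o lift i) \o s).
Proof.
move=> x_inj; rewrite Delta_recl /= lift_perm_id; congr (_ * _); last first.
  rewrite /Delta; apply: eq_bigr => j _; apply: eq_bigr => k _ /=.
  by rewrite !lift_perm_lift.
rewrite -imset_lift // big_imset /=; last first.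
  by move=> j k _ _ /x_inj /lift_inj.
rewrite [RHS](reindex_inj (@perm_inj _ s)) /=.
by apply: eq_big => [j|j _] //; rewrite lift_perm_lift.
Qed.

Lemma sum_Delta n (x : 'I_n -> I) : injective x ->
  \sum_(w : 'S_n) Delta c (u \o x \o w) = n`!%:R.
Proof.
elim: n x => [|n IHn] x x_inj.
  rewrite (eq_bigr (fun=> 1)) => [|w _]; last by rewrite /Delta big_ord0.
  by rewrite sumr_const card_Sn.
rewrite sum_perm_recl.
under eq_bigr => i _.
  under eq_bigr => s _ do rewrite Delta_lift_perm //.
  rewrite -big_distrr IHn /=; last by move=> j k /x_inj /lift_inj.
  over.
rewrite -big_distrl /=.
rewrite -(big_imset (fun a => \prod_(j in [set x j | j : 'I_n.+1] :\ a) h a j)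
  (in2W x_inj)) /=.
by rewrite sum_prod_ratio // card_imset // card_ord -natrM.
Qed.

(** Recursion on the first position: if l > 0 it carries no factor f, and its
variable joins the set T of the variables placed before position l. *)
Lemma symc_tail (f : I -> F) n (x : 'I_n -> I) l : injective x -> (l <= n)%N ->
  \sum_(w : 'S_n) Delta c (u \o x \o w) * \prod_(j < n | (l <= j)%N) f (x (w j)) =
  (l`! * (n - l)`!)%:R * split_sum f [set x i | i : 'I_n] l.
Proof.
elim: l n x => [|l IHl] n x x_inj.
  move=> _; rewrite fact0 mul1n subn0 -(sum_Delta x_inj) big_distrl /=.
  apply: eq_bigr => w _; congr (_ * _).
  rewrite /split_sum (big_pred1 set0) => [|T]; last first.
    by rewrite /= cards_eq0; case: eqVneq => [->|_]; rewrite ?sub0set ?andbF.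
  rewrite big_set0 mul1r setD0 big_imset /=; last exact: in2W.
  by rewrite [RHS](reindex_inj (@perm_inj _ w)) /=; apply: eq_bigl.
case: n x x_inj => [//|n] x x_inj ltln.
have tail_prod i (s : 'S_n) :
    \prod_(j < n.+1 | (l.+1 <= j)%N) f (x (lift_perm ord0 i s j)) =
    \prod_(j < n | (l <= j)%N) f ((x \o lift i) (s j)).
  rewrite big_mkcond big_ord_recl /= mul1r -big_mkcond /=.
  by apply: eq_big => [j|j _] //; rewrite lift_perm_lift.
rewrite sum_perm_recl.
under eq_bigr => i _.
  under eq_bigr => s _.
    rewrite Delta_lift_perm // -mulrA tail_prod.
    over.
  rewrite -big_distrr /= (IHl n (x \o lift i)) //; last by move=> j k /x_inj /lift_inj.
  rewrite imset_lift // mulrCA.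
  over.
rewrite -big_distrr /=.
rewrite -(big_imset (fun a => \prod_(j in [set x j | j : 'I_n.+1] :\ a) h a j *
   split_sum f ([set x j | j : 'I_n.+1] :\ a) l) (in2W x_inj)) /=.
by rewrite split_sumS mulrA -natrM mulnAC [(_ * l.+1)%N]mulnC.
Qed.
End SymPerm.

(** * Cauchy determinants *)

Section Cauchy.

Lemma prod_offdiag (R : comPzRingType) (n : nat) (g : 'I_n -> 'I_n -> R) :
  \prod_(i < n) \prod_(j < n | j != i) g i j =
  (\prod_(i < n) \prod_(j < n | (i < j)%N) g i j) *
  (\prod_(i < n) \prod_(j < n | (i < j)%N) g j i).
Proof.
rewrite [X in _ = _ * X](exchange_big_dep predT) //= -big_split /=.
apply: eq_bigr => i _; rewrite (bigID (fun j : 'I_n => (i < j)%N)) /=.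
by congr (_ * _); apply: eq_bigl => j; rewrite -(inj_eq val_inj) /=;
  case: ltngtP.
Qed.

(** The entries are the values at x_j of the polynomials P_k, the products of
X - y_m over m != k, so the matrix is a Vandermonde matrix in x times the matrix
C of the coefficients of the P_k. As C depends only on y, its determinant can be
read off at x = y, where the matrix is diagonal. *)
Lemma det_prod_but_one (F : fieldType) (n : nat) (x y : 'I_n -> F) :
  \det (\matrix_(j < n, k < n) \prod_(m < n | m != k) (x j - y m)) =
  (\prod_(i < n) \prod_(j < n | (i < j)%N) (x j - x i)) *
  (\prod_(i < n) \prod_(j < n | (i < j)%N) (y i - y j)).
Proof.
case: n x y => [|n] x y; first by rewrite det_mx00 !big_ord0 mulr1.
pose P k : {poly F} := \prod_(m < n.+1 | m != k) ('X - (y m)%:P).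
have PE k t : (P k).[t] = \prod_(m < n.+1 | m != k) (t - y m).
  by rewrite horner_prod; apply: eq_bigr => m _; rewrite !hornerE.
have szP k : size (P k) = n.+1.
  rewrite /P -big_enum /= size_prod_XsubC -cardE.
  by rewrite -[LHS]/(#|predC1 k|.+1) cardC1 card_ord.
pose C : 'M[F]_n.+1 := \matrix_(i, k) (P k)`_i.
pose V (z : 'I_n.+1 -> F) := Vandermonde n.+1 (\row_j z j).
have detV z : \det (V z) = \prod_(i < n.+1) \prod_(j < n.+1 | (i < j)%N) (z j - z i).
  rewrite det_Vandermonde; apply: eq_bigr => i _; apply: eq_bigr => j _.
  by rewrite !mxE.
have factV (z : 'I_n.+1 -> F) :
    \matrix_(j < n.+1, k < n.+1) (\prod_(m < n.+1 | m != k) (z j - y m)) = (V z)^T *m C.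
  apply/matrixP => j k; rewrite !mxE -PE (horner_coef_wide _ (eq_leq (szP k))).
  by apply: eq_bigr => i _; rewrite !mxE mulrC.
rewrite factV det_mulmx det_tr detV; congr (_ * _).
have := congr1 (fun A => \det A) (factV y).
rewrite det_mulmx det_tr detV.
have -> : \matrix_(j < n.+1, k < n.+1) (\prod_(m < n.+1 | m != k) (y j - y m)) =
          diag_mx (\row_k \prod_(m < n.+1 | m != k) (y k - y m)).
  apply/matrixP => j k; rewrite !mxE; case: eqVneq => [-> //|jNk].
  by rewrite mulr0n (bigD1 j) //= subrr mul0r.
rewrite det_diag; under eq_bigr do rewrite mxE.
rewrite prod_offdiag mulrC.
set W := (X in X * _ = _).
(* At x = y the formula determines det C only up to the Vandermonde factor W of
   y. If W = 0 then two of the y_i agree and C has two equal columns. *)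
have [WE0 _|WN0 /(mulfI WN0) //] := eqVneq W 0.
have [i [j [iltj yij]]] : exists i j : 'I_n.+1, (i < j)%N /\ y i = y j.
  move/eqP: WE0 => /prodf_eq0[i _ /prodf_eq0[j iltj]].
  by rewrite subr_eq0 => /eqP yji; exists i, j.
have iNj : i != j by rewrite -(inj_eq val_inj) /= neq_ltn iltj.
rewrite [RHS](bigD1 i) //= (bigD1 j) //= yij subrr !mul0r.
rewrite -det_tr (determinant_alternate iNj) // => k; rewrite !mxE.
have Pval l : P l = (\prod_(m < n.+1) ('X - (y m)%:P)) %/ ('X - (y l)%:P).
  by rewrite [in RHS](bigD1 l) //= mulKp // polyXsubC_eq0.
by rewrite !Pval yij.
Qed.

(** The y_k may coincide: the shifted variables u_k - c are allowed to meet the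
unshifted ones. *)
Lemma det_Cauchy (F : fieldType) (n : nat) (x y : 'I_n -> F) :
    (forall j k, x j != y k) ->
  \det (\matrix_(j < n, k < n) (x j - y k)^-1) =
  ((\prod_(i < n) \prod_(j < n | (i < j)%N) (x j - x i)) *
   (\prod_(i < n) \prod_(j < n | (i < j)%N) (y i - y j))) /
  \prod_(i < n) \prod_(k < n) (x i - y k).
Proof.
move=> xNy; have xyN0 j k : x j - y k != 0 by rewrite subr_eq0.
have N0 : \prod_(i < n) \prod_(k < n) (x i - y k) != 0.
  by apply/prodf_neq0 => i _; apply/prodf_neq0.
apply: canRL (mulfK N0) _; rewrite -det_prod_but_one mulrC.
have -> : \prod_(i < n) \prod_(k < n) (x i - y k) =
          \det (diag_mx (\row_i \prod_(k < n) (x i - y k))).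
  by rewrite det_diag; apply: eq_bigr => i _; rewrite mxE.
rewrite -det_mulmx; congr (\det _); apply/matrixP => j k.
by rewrite mul_diag_mx !mxE (bigD1 k) //= mulrAC mulfV ?mul1r.
Qed.

Lemma det_sub_expand (R : comPzRingType) (n : nat) (a b : 'I_n -> 'I_n -> R) :
  \det (\matrix_(j < n, k < n) (a j k - b j k)) =
  \sum_(T : {set 'I_n}) (-1) ^+ #|T| *
    \det (\matrix_(j < n, k < n) (if k \in T then b j k else a j k)).
Proof.
rewrite -det_tr {1}/determinant.
under eq_bigr => s _.
  under eq_bigr => k _ do rewrite !mxE addrC.
  rewrite bigA_distr big_distrr /=.
  over.
rewrite exchange_big /=; apply: eq_bigr => T _.
rewrite -[in RHS]det_tr big_distrr /=; apply: eq_bigr => s _.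
rewrite mulrCA; congr (_ * _).
under [in RHS]eq_bigr => k _ do rewrite !mxE.
rewrite -prodr_const [in RHS]big_mkcond -big_split /=.
by apply: eq_bigr => k _; case: ifP => _; rewrite ?mulN1r ?mul1r.
Qed.

End Cauchy.

(** * Expansion of the Izergin determinant *)

Section Izergin.

Variables (F : fieldType) (n : nat) (c : F) (u v : 'I_n -> F).
Hypotheses (u_inj : injective u) (v_inj : injective v).
Hypothesis uNv : forall j k, u j != v k.
Hypothesis vucN0 : forall j k, v j - u k + c != 0.

Local Notation h i j := ((u i - u j - c) / (u i - u j)).
Local Notation f j := (\prod_(k < n) ((u j - v k - c) / (u j - v k))).

(** Shifting by c the variables in T changes only the differences across T, and
the ratio of new to old is the same whichever of the two indices is smaller. *)
Lemma prod_shift (T : {set 'I_n}) :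
  \prod_(i < n) \prod_(j < n | (i < j)%N)
     ((if i \in T then u i - c else u i) - (if j \in T then u j - c else u j)) =
  \prod_(i < n) \prod_(j < n | (i < j)%N) (u i - u j) *
  \prod_(i in T) \prod_(j in ~: T) h i j.
Proof.
pose H i j := if (i \in T) && (j \notin T) then h i j else 1.
have -> : \prod_(i in T) \prod_(j in ~: T) h i j =
          \prod_(i < n) \prod_(j < n | j != i) H i j.
  rewrite big_mkcond; apply: eq_bigr => i _.
  rewrite big_mkcond [RHS]big_mkcond /H; case: ifP => iT /=; last first.
    by rewrite big1 // => j _; rewrite if_same.
  apply: eq_bigr => j _; rewrite inE; have [->|//] := eqVneq j i.
  by rewrite iT.
rewrite prod_offdiag -!big_split /=; apply: eq_bigr => i _.
rewrite -!big_split /=; apply: eq_bigr => j iltj.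
have uijN0 : u i - u j != 0.
  by rewrite subr_eq0 (inj_eq u_inj) -(inj_eq val_inj) neq_ltn iltj.
have ujiN0 : u j - u i != 0 by rewrite -opprB oppr_eq0.
rewrite /H; case: (i \in T); case: (j \in T); rewrite /= ?mulr1 ?mul1r //.
- by ring.
- by field.
- by field.
Qed.

(** In the Cauchy determinant of index T, the factors v_i - u_k + c with k in T
are exactly the denominators of the shifted u_k and cancel; the others, over the
denominators v_i - u_k, make up f k. *)
Lemma Izergin_expansion :
  c ^+ n * (\prod_(i < n) \prod_(k < n) (v i - u k + c))
    / ((\prod_(i < n) \prod_(j < n | (i < j)%N) (v j - v i))
       * (\prod_(i < n) \prod_(j < n | (i < j)%N) (u i - u j)))
    * \det (\matrix_(j < n, k < n) ((v j - u k + c) * (v j - u k))^-1) =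
  \sum_(T : {set 'I_n}) (-1) ^+ #|T| *
    ((\prod_(i in T) \prod_(j in ~: T) h i j) * \prod_(j in ~: T) f j).
Proof.
have vuN0 j k : v j - u k != 0 by rewrite subr_eq0 eq_sym.
have Vv0 : \prod_(i < n) \prod_(j < n | (i < j)%N) (v j - v i) != 0.
  apply/prodf_neq0 => i _; apply/prodf_neq0 => j iltj.
  by rewrite subr_eq0 (inj_eq v_inj) -(inj_eq val_inj) neq_ltn iltj orbT.
have Vu0 : \prod_(i < n) \prod_(j < n | (i < j)%N) (u i - u j) != 0.
  apply/prodf_neq0 => i _; apply/prodf_neq0 => j iltj.
  by rewrite subr_eq0 (inj_eq u_inj) -(inj_eq val_inj) neq_ltn iltj.
(* One factor c per row gives the partial fractions of the entries. *)
have E : c ^+ n * \det (\matrix_(j < n, k < n) ((v j - u k + c) * (v j - u k))^-1) =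
    \det (\matrix_(j < n, k < n) ((v j - u k)^-1 - (v j - u k + c)^-1)).
  rewrite -detZ; congr (\det _); apply/matrixP => j k; rewrite !mxE.
  by field; rewrite vuN0 vucN0.
rewrite [c ^+ n * _]mulrC [_ * c ^+ n / _]mulrAC -[_ * c ^+ n * _]mulrA E.
rewrite det_sub_expand big_distrr /=.
apply: eq_bigr => T _; rewrite mulrCA; congr (_ * _).
pose u' k := if k \in T then u k - c else u k.
have vNu' j k : v j != u' k.
  rewrite /u' -subr_eq0; case: ifP => _ //.
  by rewrite opprB addrA addrAC.
have -> : \matrix_(j < n, k < n) (if k \in T then (v j - u k + c)^-1 else (v j - u k)^-1)
     = \matrix_(j < n, k < n) (v j - u' k)^-1.
  apply/matrixP => j k; rewrite !mxE /u'; case: ifP => // _.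
  by rewrite opprB addrA addrAC.
rewrite det_Cauchy // prod_shift.
have -> : \prod_(j in ~: T) f j =
    (\prod_(i < n) \prod_(k < n) (v i - u k + c)) /
    \prod_(i < n) \prod_(k < n) (v i - u' k).
  rewrite [in X in X / _]exchange_big [in X in _ / X]exchange_big /=.
  rewrite -prodf_div big_mkcond; apply: eq_bigr => k _; rewrite inE -prodf_div.
  rewrite /u'; case: ifP => [kNT|/negbFE kT].
    apply: eq_bigr => i _; rewrite (negbTE kNT) -[v i - u k]opprB.
    by rewrite -[RHS]mulrNN -invrN opprK opprD opprK.
  rewrite kT big1 // => i _; rewrite opprB addrA addrAC divff //.
have ZN0 : \prod_(i < n) \prod_(k < n) (v i - u' k) != 0.
  by apply/prodf_neq0 => i _; apply/prodf_neq0 => k _; rewrite subr_eq0.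
by field; rewrite Vv0 Vu0 ZN0.
Qed.

End Izergin.

(** * Powers of the operator 1 - tau *)

Section Tau.

Lemma iter_sub_additive (R : pzRingType) (f : {additive R -> R}) m (p : R) :
  iter m (fun q => q - f q) p =
  \sum_(l < m.+1) (-1) ^+ l * iter l f p *+ 'C(m, l).
Proof.
elim: m => [|m IHm]; first by rewrite big_ord1 /= expr0 mul1r bin0.
rewrite iterS IHm raddf_sum -sumrN big_ord_recl [RHS]big_ord_recl /= !bin0.
rewrite -addrA; congr (_ + _).
under [RHS]eq_bigr => l _ do rewrite /bump /= add1n binS mulrnDr.
rewrite big_split /=; congr (_ + _).
  rewrite [RHS]big_ord_recr /= bin_small // mulr0n addr0.
  by apply: eq_bigr => l _.
apply: eq_bigr => l _.
by rewrite raddfMn raddfMsign exprS mulN1r mulNr mulNrn.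
Qed.

Variables (F : fieldType) (n : nat).

Local Notation factors := {mpoly F[#|{: 'I_n * 'I_n}|]}.

Lemma tau_factorE j k : tau (factor j k : factors) = tau_factor F (j, k).
Proof.
by rewrite /tau /factor comp_mpolyXU -tnth_nth tnth_mktuple enum_rankK.
Qed.

(** One application of tau moves the row of factors with index j to j + 1 and
sends the last row to 1, so the product over j >= l becomes the one over
j >= l + 1. *)
Lemma iter_tau l :
  iter l (@tau F n) (\prod_(j < n) \prod_(k < n) factor j k) =
  \prod_(j < n | (l <= j)%N) \prod_(k < n) factor j k.
Proof.
elim: l => [|l IHl]; first by apply: eq_bigl.
rewrite iterS IHl {1}/tau rmorph_prod /=.
under eq_bigr => j _.
  rewrite rmorph_prod /=.
  under eq_bigr => k _ do rewrite -/(tau _) tau_factorE /tau_factor /=.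
  over.
move: (#|_|) (@factor F n) => N g.
case: n g => [|m] g; first by rewrite !big_ord0.
rewrite big_mkcond big_ord_recr [RHS]big_mkcond [RHS]big_ord_recl /= mul1r.
rewrite [X in if _ then X else _]big1 => [|k _]; last first.
  by rewrite insubF //= ltnn.
rewrite if_same mulr1; apply: eq_bigr => j _ /=.
rewrite ltnS; case: ifP => // _; apply: eq_bigr => k _.
have jm : (j.+1 < m.+1)%N by rewrite ltnS.
by rewrite (insubT (fun i => i < m.+1)%N jm); congr g; apply: val_inj.
Qed.

Lemma eval_factor c v j k u :
  eval_factors c v (factor j k : factors) u = (u j - v k - c) / (u j - v k).
Proof. by rewrite /eval_factors /factor mevalXU enum_rankK. Qed.

Lemma eval_one_sub_tau_pow (c : F) (v u : 'I_n -> F) :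
  eval_factors c v (one_sub_tau_pow n (\prod_(j < n) \prod_(k < n) factor j k)) u =
  \sum_(l < n.+1) (-1) ^+ l *
    (\prod_(j < n | (l <= j)%N) \prod_(k < n) ((u j - v k - c) / (u j - v k)))
    *+ 'C(n, l).
Proof.
pose phi : {additive factors -> factors} :=
  comp_mpoly [tuple tau_factor F (enum_val i) | i < #|{: 'I_n * 'I_n}|].
rewrite /one_sub_tau_pow -[iter n _ _]/(iter n (fun q => q - phi q) _).
rewrite iter_sub_additive.
rewrite {1}/eval_factors rmorph_sum /=; apply: eq_bigr => l _.
rewrite rmorphMn rmorphMsign iter_tau rmorph_prod /=; congr (_ * _ *+ _).
apply: eq_bigr => j _; rewrite rmorph_prod /=; apply: eq_bigr => k _.
exact: eval_factor.
Qed.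
End Tau.

(** * The symmetrization formula *)

Section Main.

Variables (F : fieldType) (n : nat) (c : F) (u v : 'I_n -> F).
Hypotheses (u_inj : injective u) (v_inj : injective v).
Hypothesis uNv : forall j k, u j != v k.
Hypothesis vucN0 : forall j k, v j - u k + c != 0.

(** Both sides are compared for each l with the part #|T| = l of the sum over
subsets. *)
Lemma symc_one_sub_tau_pow :
  symc c (eval_factors c v
           (one_sub_tau_pow n (\prod_(j < n) \prod_(k < n) factor j k))) u
  = (n`!%:R * c ^+ n * \prod_(i < n) \prod_(k < n) (v i - u k + c))
    / ((\prod_(i < n) \prod_(j < n | (i < j)%N) (v j - v i))
       * (\prod_(i < n) \prod_(j < n | (i < j)%N) (u i - u j)))
    * \det (\matrix_(j < n, k < n) ((v j - u k + c) * (v j - u k))^-1).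
Proof.
rewrite -!mulrA [c ^+ n * _]mulrA [X in _ = _ * X]mulrA Izergin_expansion //.
rewrite /symc; under eq_bigr => w _ do rewrite eval_one_sub_tau_pow big_distrr /=.
rewrite exchange_big /=.
rewrite (partition_big (fun T : {set 'I_n} => inord #|T| : 'I_n.+1) xpredT) //=.
rewrite big_distrr; apply: eq_bigr => l _.
have ln : (l <= n)%N by rewrite -ltnS.
under eq_bigr => w _ do rewrite -mulrnAr mulrCA.
rewrite -big_distrr /=.
rewrite -[in RHS](bin_fact ln) natrM -mulrA.
have := symc_tail c u_inj (fun j => \prod_(k < n) ((u j - v k - c) / (u j - v k)))
  (@inj_id _) ln.
have -> : [set id i | i : 'I_n] = setT.
  by apply/setP => i; rewrite inE; apply/imsetP; exists i.
move=> E.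
under eq_bigr => w _ do rewrite -mulr_natl mulrCA.
rewrite -big_distrr /= mulrCA; congr (_ * _).
rewrite [X in _ * X](_ : _ = \sum_(w : 'S_n) Delta c (u \o id \o w) *
    \prod_(j < n | (l <= j)%N) \prod_(k < n) ((u (w j) - v k - c) / (u (w j) - v k))) //.
rewrite {}E mulrCA; congr (_ * _); rewrite /split_sum big_distrr /=.
have inord_card (T : {set 'I_n}) : (inord #|T| == l) = (#|T| == l :> nat).
  by rewrite -(inj_eq val_inj) /= inordK // ltnS -[leqRHS]card_ord max_card.
apply: eq_big => [T|T]; first by rewrite inord_card subsetT.
by rewrite subsetT setTD => /eqP <-.
Qed.
End Main.

Theorem theorem4p13 (R : realType) (n : nat) (hn : (1 <= n)%N)
    (c : R[i]) (u v : 'I_n -> R[i])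
    (hu : forall i j : 'I_n, i != j -> u i != u j)
    (hv : forall i j : 'I_n, i != j -> v i != v j)
    (huv : forall j k : 'I_n, u j != v k)
    (hvuc : forall j k : 'I_n, v j - u k + c != 0) :
  symc c (eval_factors c v
           (one_sub_tau_pow n (\prod_(j < n) \prod_(k < n) factor j k))) u
  = (n`!%:R * c ^+ n * \prod_(i < n) \prod_(k < n) (v i - u k + c))
    / ((\prod_(i < n) \prod_(j < n | (i < j)%N) (v j - v i))
       * (\prod_(i < n) \prod_(j < n | (i < j)%N) (u i - u j)))
    * \det (\matrix_(j < n, k < n) ((v j - u k + c) * (v j - u k))^-1).
Proof.
apply: symc_one_sub_tau_pow => // i j /eqP.
- by apply: contraTeq => /hu.
- by apply: contraTeq => /hv.
Qed.
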